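(* Let $R$ be a coherent regular ring. Then $R$ is locally Cohen-Macaulay, i.e. $R_p$ is Cohen-Macaulay (in the sense defined in the context) for every prime ideal $p$ of $R$.
   Context: All rings are commutative with identity. A ring is coherent if every finitely generated ideal is finitely presented; it is regular if every finitely generated ideal has finite projective dimension. For $x\in R$ let $C(x)$ be the complex $0\to R\to R_x\to 0$ ($R$ in degree $0$, the map being the natural localization map); for a finite sequence $\mathbf x=x_1,\dots,x_\ell$ put $C(\mathbf x)=C(x_1)\otimes_R\cdots\otimes_R C(x_\ell)$, and define the Čech cohomology $H^i_{\mathbf x}(M)$ of an $R$-module $M$ as the $i$th cohomology of $C(\mathbf x)\otimes_R M$; $\ell(\mathbf x)=\ell$ is the length. Let $K(x)$ be the complex $0\to R\xrightarrow{x}R\to 0$ (degrees $1,0$), $K(\mathbf x)=K(x_1)\otimes\cdots\otimes K(x_\ell)$, and $H_i(\mathbf x)$ its homology. For $m\ge n$ there is a chain map $K(\mathbf x^m)\to K(\mathbf x^n)$ (where $\mathbf x^m=x_1^m,\dots,x_\ell^m$) which is the tensor product of the maps $K(x_i^m)\to K(x_i^n)$ given by multiplication by $x_i^{m-n}$ in degree $1$ and the identity in degree $0$. The sequence $\mathbf x$ is weakly proregular if for every $n$ there is $m\ge n$ such that the induced maps $H_i(\mathbf x^m)\to H_i(\mathbf x^n)$ are zero for all $i\ge1$. A finite sequence $\mathbf x$ is a parameter sequence on $R$ if (1) $\mathbf x$ is weakly proregular, (2) $(\mathbf x)R\neq R$, and (3) $H^{\ell(\mathbf x)}_{\mathbf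 x}(R)_p\neq0$ for every prime $p\supseteq(\mathbf x)R$; the empty sequence is a parameter sequence of length $0$. It is a strong parameter sequence if $x_1,\dots,x_i$ is a parameter sequence for each $i=1,\dots,\ell(\mathbf x)$. A sequence $\mathbf x$ is a regular sequence on an $R$-module $M$ if each $x_i$ is a non-zero-divisor on $M/(x_1,\dots,x_{i-1})M$ and $M\neq(\mathbf x)M$ (the empty sequence is regular). A ring $R$ is Cohen-Macaulay if every strong parameter sequence on $R$ is a regular sequence on $R$. *)

(* Defs.v *)
From HB Require Import structures.
From mathcomp Require Import all_boot all_order all_algebra.
Set Implicit Arguments. Unset Strict Implicit. Unset Printing Implicit Defensive.
Import GRing.Theory.
Local Open Scope ring_scope.

Section Defs.
Variable R : comPzRingType.

Definition is_ideal (I : R -> Prop) : Prop :=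
  I 0 /\ (forall a b, I a -> I b -> I (a + b)) /\ (forall r a, I a -> I (r * a)).

Definition is_prime_ideal (p : R -> Prop) : Prop :=
  is_ideal p /\ ~ p 1 /\ (forall a b, p (a * b) -> p a \/ p b).

Definition ideal_gen (n : nat) (a : 'I_n -> R) : R -> Prop :=
  fun r => exists c : 'I_n -> R, r = \sum_(i < n) c i * a i.

Definition ideal_seq (s : seq R) : R -> Prop :=
  fun r => exists c : 'I_(size s) -> R, r = \sum_(i < size s) c i * s`_i.

Definition fin_gen_ideal (I : R -> Prop) : Prop :=
  exists n (a : 'I_n -> R), forall r, I r <-> ideal_gen a r.

(* I is finitely presented as an R-module: there is an exact sequence
   R^m --B--> R^n --a--> I --> 0. *)
Definition fin_pres_ideal (I : R -> Prop) : Prop :=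
  exists n (a : 'I_n -> R) m (B : 'I_m -> 'I_n -> R),
    (forall r, I r <-> ideal_gen a r) /\
    (forall c : 'I_n -> R,
        \sum_(j < n) c j * a j = 0 <->
        exists e : 'I_m -> R, forall j, c j = \sum_(k < m) e k * B k j).

Definition coherent : Prop :=
  forall I : R -> Prop, fin_gen_ideal I -> fin_pres_ideal I.

Definition projective (P : lmodType R) : Prop :=
  forall (M N : lmodType R) (f : {linear M -> N}) (g : {linear P -> N}),
    (forall y : N, exists x : M, f x = y) ->
    exists h : {linear P -> M}, forall v, f (h v) = g v.

(* I has finite projective dimension: there is an exact sequence
   0 -> P_n -> ... -> P_1 -> P_0 -> I -> 0 with all P_i projective
   (encoded as P_0 -> R with image I, P_i = 0 for i > n). *)
Definition fin_proj_dim (I : R -> Prop) : Prop :=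
  exists (n : nat) (P : nat -> lmodType R)
         (d : forall i, {linear P i.+1 -> P i}) (d0 : {linear P 0 -> R^o}),
    (forall i, projective (P i)) /\
    (forall i, (n < i)%N -> forall v : P i, v = 0) /\
    (forall r : R, I r <-> exists v : P 0, d0 v = r) /\
    (forall v : P 0, d0 v = 0 <-> exists w, d 0%N w = v) /\
    (forall i (v : P i.+1), d i v = 0 <-> exists w, d i.+1 w = v).

Definition regular_ring : Prop :=
  forall I : R -> Prop, fin_gen_ideal I -> fin_proj_dim I.

End Defs.

Definition is_localization_at (R S : comPzRingType) (p : R -> Prop)
  (phi : {rmorphism R -> S}) : Prop :=
  (forall s, ~ p s -> exists z, phi s * z = 1) /\
  (forall y : S, exists a s, ~ p s /\ y * phi s = phi a) /\
  (forall a, phi a = 0 -> exists s, ~ p s /\ s * a = 0).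

Section CM.
Variable S : comPzRingType.

(* K(x) for x = x_1..x_l, with basis e_T (T a subset of {1..l}); a chain is
   a function {set 'I_l} -> S, of degree i when supported on #|T| = i.
   d(e_T) = sum_{j in T} (-1)^{#{k in T | k < j}} x_j e_{T \ j}. *)
Definition koszul_d (l : nat) (x : 'I_l -> S) (f : {set 'I_l} -> S)
  : {set 'I_l} -> S :=
  fun U => \sum_(j < l | j \notin U)
      (-1) ^+ #|[set k in U | (k < j)%N]| * x j * f (j |: U).

Definition homog (l i : nat) (f : {set 'I_l} -> S) : Prop :=
  forall T : {set 'I_l}, #|T| != i -> f T = 0.

(* the chain map K(x^m) -> K(x^n) (m >= n): e_T |-> prod_{j in T} x_j^(m-n) e_T *)
Definition koszul_trans (l m n : nat) (x : 'I_l -> S) (f : {set 'I_l} -> S)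
  : {set 'I_l} -> S :=
  fun T => (\prod_(j in T) x j ^+ (m - n)) * f T.

Definition koszul_map_zero (l m n i : nat) (x : 'I_l -> S) : Prop :=
  forall z : {set 'I_l} -> S,
    homog i z -> koszul_d (fun j => x j ^+ m) z = (fun _ => 0) ->
    exists w : {set 'I_l} -> S, homog i.+1 w /\
      koszul_d (fun j => x j ^+ n) w = koszul_trans m n x z.

Definition weakly_proregular (x : seq S) : Prop :=
  forall n : nat, (0 < n)%N -> exists m : nat, (n <= m)%N /\
    forall i : nat, (1 <= i)%N ->
      koszul_map_zero m n i (fun j : 'I_(size x) => x`_j).

(* H^l_x(S) = coker( (+)_i S_{u_i} -> S_u ), u = x_1...x_l,
   u_i = prod_{j <> i} x_j (top term of C(x) (x) S, with
   S_{x_1} (x) ... (x) S_{x_l} = S_u).  An element a/u^k of S_u lies in the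
   image iff a/u^k = sum_i b_i x_i^N / u^N in S_u, i.e.
   u^t (a u^N - u^k sum_i b_i x_i^N) = 0 for some t.
   H^l_x(S)_q <> 0 iff some class c satisfies s c <> 0 for all s notin q. *)
Definition top_cech_image (x : seq S) (y : S) (k : nat) : Prop :=
  let u := \prod_(i < size x) x`_i in
  exists (N t : nat) (b : 'I_(size x) -> S),
    u ^+ t * (y * u ^+ N - u ^+ k * \sum_(i < size x) b i * x`_i ^+ N) = 0.

Definition top_cech_loc_nonzero (x : seq S) (q : S -> Prop) : Prop :=
  exists (a : S) (k : nat), forall s, ~ q s -> ~ top_cech_image x (s * a) k.

Definition parameter_seq (x : seq S) : Prop :=
  weakly_proregular x /\
  ~ ideal_seq x 1 /\
  (forall q : S -> Prop, is_prime_ideal q ->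
     (forall r, ideal_seq x r -> q r) -> top_cech_loc_nonzero x q).

Definition strong_parameter_seq (x : seq S) : Prop :=
  forall i : nat, (1 <= i <= size x)%N -> parameter_seq (take i x).

Definition regular_seq (x : seq S) : Prop :=
  (forall i : nat, (i < size x)%N -> forall y : S,
      ideal_seq (take i x) (x`_i * y) -> ideal_seq (take i x) y) /\
  ~ ideal_seq x 1.

Definition cohen_macaulay : Prop :=
  forall x : seq S, strong_parameter_seq x -> regular_seq x.

End CM.

(* Main.v *)
Require Import Defs.
From HB Require Import structures.
From mathcomp Require Import all_boot all_order all_algebra.
From mathcomp Require classical_sets.
From mathcomp Require Import boolp.
From mathcomp Require Import ring zify.

Set Implicit Arguments. Unset Strict Implicit. Unset Printing Implicit Defensive.
Import GRing.Theory.
Local Open Scope ring_scope.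

(** Suppose [x_1..x_i] is regular on the local ring [S = R_p] but [x_(i+1)] kills
    a nonzero [y] modulo [I = (x_1..x_i)].  Localize at a minimal prime [q] of
    [I : y]; in [T = S_q] every finite subset of the maximal ideal kills a nonzero
    element of [T / I], so by the Auslander-Buchsbaum argument minimal free
    resolutions of ideals of [T] stop in degree at most [i].  Chasing the double
    complex [K(x^M) (x) F], with [F] such a resolution of [T / (x^M)] and weak
    proregularity used once per row, gives [u^(M-N) \in (x^M) T] for
    [u = x_1...x_(i+1)], so [H^(i+1)_x(S)_q = 0] and [x_1..x_(i+1)] is not a
    parameter sequence.

    Projective resolutions, of arbitrary rank, enter only through the existence of
    a matrix [H] with [D_k H D_k = D_k] for some differential [D_k] of a
    resolution by finite free modules; this condition passes between resolutions
    and to localizations, and over a local ring it makes a minimal resolution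
    finite. *)

(** * Localization at a prime *)

Section Localization.
Variables (S : comPzRingType) (q : S -> Prop).
Hypothesis qP : is_prime_ideal q.

Let q1 : ~ q 1. Proof. by case: qP => _ []. Qed.

Lemma prime_compl_mul a b : ~ q a -> ~ q b -> ~ q (a * b).
Proof. by case: qP => _ [_ h] na nb /h []. Qed.

Definition denom_pred : pred S := fun s => `[< ~ q s >].
Definition fracs := (S * {s : S | denom_pred s})%type.
HB.instance Definition _ := Choice.on fracs.

Lemma denomP (x : fracs) : ~ q (val x.2).
Proof. by case: x => a [s] /= /asboolP. Qed.

Definition frac_equiv (x y : fracs) : bool :=
  `[< exists w, ~ q w /\ w * (x.1 * val y.2) = w * (y.1 * val x.2) >].

Lemma frac_equiv_refl : reflexive frac_equiv.
Proof. by move=> x; apply/asboolP; exists 1. Qed.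

Lemma frac_equiv_sym : symmetric frac_equiv.
Proof.
by move=> x y; apply/asboolP/asboolP => -[w [nw e]]; exists w.
Qed.

Lemma frac_equiv_trans : transitive frac_equiv.
Proof.
move=> y x z /asboolP[w [nw e]] /asboolP[v [nv f]]; apply/asboolP.
exists (w * v * val y.2); split.
  exact: prime_compl_mul (prime_compl_mul nw nv) (@denomP y).
transitivity (w * (x.1 * val y.2) * (v * val z.2)); first by ring.
rewrite e; transitivity (v * (y.1 * val z.2) * (w * val x.2)); first by ring.
by rewrite f; ring.
Qed.

Canonical frac_equiv_equiv :=
  EquivRel frac_equiv frac_equiv_refl frac_equiv_sym frac_equiv_trans.

Definition loc := {eq_quot frac_equiv}%qT.
HB.instance Definition _ : EqQuotient _ frac_equiv loc := EqQuotient.on loc.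
HB.instance Definition _ := Choice.on loc.

(** Total in [s]: a denominator lying in [q] is replaced by 1 through [insubd], so computations with
    it assume [~ q s]. *)
Definition mkfrac (a s : S) : loc :=
  \pi_loc%qT (a, insubd (exist _ 1 (introT (asboolP _) q1) : {s | denom_pred s}) s).

Lemma mkfracE a s b t : ~ q s -> ~ q t ->
  mkfrac a s = mkfrac b t <-> exists w, ~ q w /\ w * (a * t) = w * (b * s).
Proof.
move=> /asboolP ns /asboolP nt; rewrite /mkfrac; split.
  by move=> /eqP; rewrite eqmodE => /asboolP /=; rewrite !insubdK.
move=> h; apply/eqP; rewrite eqmodE; apply/asboolP => /=.
by rewrite !insubdK.
Qed.

Lemma mkfrac_eqw a s b t w : ~ q s -> ~ q t -> ~ q w ->
  w * (a * t) = w * (b * s) -> mkfrac a s = mkfrac b t.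
Proof. by move=> ns nt nw e; apply/mkfracE => //; exists w. Qed.

Definition num (x : loc) := (repr x).1.
Definition den (x : loc) := val (repr x).2.

Lemma denN x : ~ q (den x). Proof. exact: denomP. Qed.

Lemma fracK x : mkfrac (num x) (den x) = x.
Proof.
rewrite -[RHS]reprK /mkfrac /num /den; congr (\pi%qT _).
case: (repr x) => a s /=; congr pair; apply: val_inj.
by rewrite insubdK //; case: s.
Qed.

Lemma locP (x : loc) : exists a s, ~ q s /\ x = mkfrac a s.
Proof. by exists (num x), (den x); rewrite fracK; split=> //; exact: denN. Qed.

(** The operations below are defined on chosen representatives; this relation lets them be evaluated
    on any fraction. *)
Lemma frac_repr a s : ~ q s ->
  exists w, ~ q w /\ w * (num (mkfrac a s) * s) = w * (a * den (mkfrac a s)).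
Proof. by move=> ns; apply/mkfracE => //; [exact: denN | rewrite fracK]. Qed.

Definition loc_add x y := mkfrac (num x * den y + num y * den x) (den x * den y).
Definition loc_mul x y := mkfrac (num x * num y) (den x * den y).
Definition loc_opp x := mkfrac (- num x) (den x).

Lemma loc_addE a s b t : ~ q s -> ~ q t ->
  loc_add (mkfrac a s) (mkfrac b t) = mkfrac (a * t + b * s) (s * t).
Proof.
move=> ns nt; have [w [nw e]] := frac_repr a ns; have [v [nv f]] := frac_repr b nt.
apply: (@mkfrac_eqw _ _ _ _ (w * v)); do ?[exact: denN | apply: prime_compl_mul] => //.
set a' := num _ in e *; set s' := den _ in e *.
set b' := num _ in f *; set t' := den _ in f *.
transitivity (w * (a' * s) * (v * t * t') + v * (b' * t) * (w * s * s')); first by ring.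
by rewrite e f; ring.
Qed.

Lemma loc_mulE a s b t : ~ q s -> ~ q t ->
  loc_mul (mkfrac a s) (mkfrac b t) = mkfrac (a * b) (s * t).
Proof.
move=> ns nt; have [w [nw e]] := frac_repr a ns; have [v [nv f]] := frac_repr b nt.
apply: (@mkfrac_eqw _ _ _ _ (w * v)); do ?[exact: denN | apply: prime_compl_mul] => //.
set a' := num _ in e *; set s' := den _ in e *.
set b' := num _ in f *; set t' := den _ in f *.
transitivity (w * (a' * s) * (v * (b' * t))); first by ring.
by rewrite e f; ring.
Qed.

Lemma loc_oppE a s : ~ q s -> loc_opp (mkfrac a s) = mkfrac (- a) s.
Proof.
move=> ns; have [w [nw e]] := frac_repr a ns.
apply: (mkfrac_eqw _ ns nw); first exact: denN.
set a' := num _ in e *; set s' := den _ in e *.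
transitivity (- (w * (a' * s))); first by ring.
by rewrite e; ring.
Qed.

Lemma mkfrac_eq a s b t : ~ q s -> ~ q t -> a * t = b * s -> mkfrac a s = mkfrac b t.
Proof. by move=> ns nt e; apply: (mkfrac_eqw ns nt q1); rewrite e. Qed.

Local Ltac nq := by do ?apply: prime_compl_mul.
Local Ltac frac_ring := apply: mkfrac_eq; [nq | nq | ring].

Lemma loc_addA : associative loc_add.
Proof.
move=> x y z; have [a [s [ns ->]]] := locP x; have [b [t [nt ->]]] := locP y.
have [c [u [nu ->]]] := locP z; rewrite !loc_addE; try nq.
frac_ring.
Qed.

Lemma loc_addC : commutative loc_add.
Proof.
move=> x y; have [a [s [ns ->]]] := locP x; have [b [t [nt ->]]] := locP y.
rewrite !loc_addE //; frac_ring.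
Qed.

Lemma loc_add0 : left_id (mkfrac 0 1) loc_add.
Proof.
move=> x; have [a [s [ns ->]]] := locP x; rewrite loc_addE //.
frac_ring.
Qed.

Lemma loc_addN : left_inverse (mkfrac 0 1) loc_opp loc_add.
Proof.
move=> x; have [a [s [ns ->]]] := locP x; rewrite loc_oppE // loc_addE //.
frac_ring.
Qed.

HB.instance Definition _ :=
  GRing.isZmodule.Build loc loc_addA loc_addC loc_add0 loc_addN.

Lemma loc_mulA : associative loc_mul.
Proof.
move=> x y z; have [a [s [ns ->]]] := locP x; have [b [t [nt ->]]] := locP y.
have [c [u [nu ->]]] := locP z; rewrite !loc_mulE; try nq.
frac_ring.
Qed.

Lemma loc_mulC : commutative loc_mul.
Proof.
move=> x y; have [a [s [ns ->]]] := locP x; have [b [t [nt ->]]] := locP y.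
rewrite !loc_mulE //; frac_ring.
Qed.

Lemma loc_mul1 : left_id (mkfrac 1 1) loc_mul.
Proof.
move=> x; have [a [s [ns ->]]] := locP x; rewrite loc_mulE //.
frac_ring.
Qed.

Lemma loc_mulD : left_distributive loc_mul loc_add.
Proof.
move=> x y z; have [a [s [ns ->]]] := locP x; have [b [t [nt ->]]] := locP y.
have [c [u [nu ->]]] := locP z; rewrite !(loc_mulE, loc_addE); try nq.
frac_ring.
Qed.

HB.instance Definition _ := GRing.Zmodule_isComPzRing.Build loc
  loc_mulA loc_mulC loc_mul1 loc_mulD.

Definition to_loc (a : S) : loc := mkfrac a 1.

Lemma to_loc_is_additive : {morph to_loc : x y / x - y}.
Proof.
move=> a b; rewrite /to_loc -[_ - mkfrac b 1]/(loc_add _ (loc_opp _)).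
rewrite loc_oppE // loc_addE //.
frac_ring.
Qed.

HB.instance Definition _ := GRing.isZmodMorphism.Build S loc to_loc to_loc_is_additive.

Lemma to_loc_is_monoid : (to_loc 1 = 1) * {morph to_loc : x y / x * y}.
Proof.
split=> // a b; rewrite /to_loc -[_ * mkfrac b 1]/(loc_mul _ _) loc_mulE //.
frac_ring.
Qed.

HB.instance Definition _ := GRing.isMonoidMorphism.Build S loc to_loc to_loc_is_monoid.

Lemma to_locP : is_localization_at q (to_loc : {rmorphism S -> loc}).
Proof.
split; [|split].
- move=> s ns; exists (mkfrac 1 s); rewrite /= /to_loc.
  rewrite -[_ * _]/(loc_mul _ _) loc_mulE //.
  by transitivity (mkfrac 1 1) => //; frac_ring.
- move=> y; have [a [s [ns ->]]] := locP y; exists a, s; split=> //=.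
  rewrite /to_loc -[_ * _]/(loc_mul _ _) loc_mulE //.
  frac_ring.
- move=> a /mkfracE => /(_ q1 q1)[w [nw e]]; exists w; split=> //.
  by move: e; rewrite mulr1 mul0r mulr0.
Qed.

End Localization.

Lemma exists_localization_at (S : comPzRingType) (q : S -> Prop) :
  is_prime_ideal q ->
  exists (T : comPzRingType) (psi : {rmorphism S -> T}), is_localization_at q psi.
Proof. by move=> qP; exists (loc qP), (to_loc qP); exact: to_locP. Qed.

(** * Projective modules and comparison of resolutions *)

Section Image.
Variables (R : comPzRingType) (M N : lmodType R) (f : {linear M -> N}).

Definition lin_image : {pred N} := fun y => `[< exists x, f x = y >].

Fact lin_image_submod_closed : submod_closed lin_image.
Proof.
split=> [|a _ _ /asboolP[x <-] /asboolP[y <-]]; apply/asboolP.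
  by exists 0; rewrite linear0.
by exists (a *: x + y); rewrite linearP.
Qed.

HB.instance Definition _ :=
  GRing.isSubmodClosed.Build R N lin_image lin_image_submod_closed.

Definition image_module := {y : N | y \in lin_image}.
HB.instance Definition _ := SubType.on image_module.
HB.instance Definition _ := Choice.on image_module.
HB.instance Definition _ := [SubChoice_isSubLmodule of image_module by <:].

Lemma image_moduleP (y : image_module) : exists x, f x = val y.
Proof. exact/asboolP/(valP y). Qed.

Section Corestriction.
Variables (P : lmodType R) (g : {linear P -> N}) (gf : forall v, exists x, f x = g v).

Definition corestr (v : P) : image_module := exist _ (g v) (introT (asboolP _) (gf v)).

Fact corestr_linear : linear corestr.
Proof. by move=> a u v; apply: val_inj; rewrite /= linearP. Qed.

HB.instance Definition _ := GRing.isLinear.Build R P image_module _ corestr corestr_linear.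
End Corestriction.

(** [projective] lifts along surjections only; corestricting [f] and [g] to the image of [f] reduces
    to that case. *)
Lemma projective_lift (P : lmodType R) (g : {linear P -> N}) : projective P ->
  (forall v, exists x, f x = g v) ->
  exists h : {linear P -> M}, forall v, f (h v) = g v.
Proof.
move=> prP gf; have ff x : exists x', f x' = f x by exists x.
have [|h hP] := prP M image_module (corestr ff) (corestr gf).
  move=> y; have [x e] := image_moduleP y; exists x; exact: val_inj.
by exists h => v; have /(congr1 val) := hP v.
Qed.

End Image.

Section FreeProjective.
Variables (R : comPzRingType) (n : nat) (M : lmodType R) (x : 'I_n -> M).

Definition row_comb (v : 'rV[R]_n) : M := \sum_i v 0 i *: x i.

Fact row_comb_linear : linear row_comb.
Proof.
move=> a u v; rewrite /row_comb scaler_sumr -big_split /=.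
by apply: eq_bigr => i _; rewrite !mxE scalerDl scalerA.
Qed.

HB.instance Definition _ := GRing.isLinear.Build R 'rV[R]_n M _ row_comb row_comb_linear.
End FreeProjective.

Lemma rV_projective (R : comPzRingType) n : projective ('rV[R]_n : lmodType R).
Proof.
move=> M N f g fS; have /choice[x xP] i := fS (g (delta_mx 0 i)).
exists (row_comb x) => v; rewrite /= /row_comb linear_sum [in RHS](row_sum_delta v).
by rewrite linear_sum; apply: eq_bigr => i _; rewrite !linearZ xP.
Qed.

Section Transfer.
Variables (R : comPzRingType) (P Q : nat -> lmodType R).
Variables (d : forall i, {linear P i.+1 -> P i}) (e : forall i, {linear Q i.+1 -> Q i}).
Hypothesis prP : forall i, projective (P i.+1).
Hypothesis prQ : forall i, projective (Q i.+1).
Hypothesis exP : forall i (v : P i.+1), d i v = 0 <-> exists w, d i.+1 w = v.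
Hypothesis exQ : forall i (v : Q i.+1), e i v = 0 <-> exists w, e i.+1 w = v.

(* The degree [k] part of comparison maps [g : Q -> P], [f : P -> Q] and of a
   homotopy [s] from [f g] to the identity of [Q], keeping only what is needed
   to continue them in degree [k.+1]. *)
Definition comparison k :=
  exists (g : {linear Q k -> P k}) (f : {linear P k -> Q k}) (s : {linear Q k -> Q k.+1}),
  [/\ forall v, exists w, d k w = g (e k v),
      forall v, exists w, e k w = f (d k v)
    & forall v, e k v - f (g (e k v)) = e k (s (e k v))].

Let dd i v : d i (d i.+1 v) = 0. Proof. by apply/exP; exists v. Qed.
Let ee i v : e i (e i.+1 v) = 0. Proof. by apply/exQ; exists v. Qed.

Lemma comparison_lift k (g : {linear Q k -> P k}) (f : {linear P k -> Q k}) :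
  (forall v, exists w, d k w = g (e k v)) ->
  (forall v, exists w, e k w = f (d k v)) ->
  exists (g' : {linear Q k.+1 -> P k.+1}) (f' : {linear P k.+1 -> Q k.+1}),
   (forall v, d k (g' v) = g (e k v)) /\ (forall v, e k (f' v) = f (d k v)).
Proof.
move=> hg hf.
have [g' g'P] := @projective_lift _ _ _ (d k) _ (g \o e k)%FUN (@prQ k) hg.
have [f' f'P] := @projective_lift _ _ _ (e k) _ (f \o d k)%FUN (@prP k) hf.
by exists g', f'.
Qed.

Lemma comparison_step k : comparison k -> comparison k.+1.
Proof.
move=> [g [f [s [hg hf hs]]]]; have [g' [f' [g'P f'P]]] := comparison_lift hg hf.
(* By [hs], the map [e k] kills [1 - f' g' - s e], so exactness and projectivity lift this map to
   the next homotopy [s']. *)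
pose h : {linear Q k.+1 -> Q k.+1} := (idfun \- (f' \o g') \- (s \o e k))%R.
have [s' s'P] : exists s' : {linear Q k.+1 -> Q k.+2}, forall v, e k.+1 (s' v) = h v.
  apply: projective_lift => // v; apply/exQ.
  by rewrite /= !linearB /= f'P g'P -hs subrr.
exists g', f', s'; split.
- by move=> v; apply/exP; rewrite g'P ee linear0.
- by move=> v; apply/exQ; rewrite f'P dd linear0.
- by move=> v; rewrite s'P /= ee linear0 subr0.
Qed.

(** The map [s + f' h g] works: [e f' h g e = f d h d g' = f d g' = f g e], and the homotopy [s]
    supplies the missing [e - f g e]. *)
Lemma von_neumann_transfer k (h : {linear P k -> P k.+1}) : comparison 0 ->
  (forall v, d k (h (d k v)) = d k v) ->
  exists s : {linear Q k -> Q k.+1}, forall v, e k (s (e k v)) = e k v.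
Proof.
move=> c0 hP; have : comparison k by elim: k {h hP} => // k; exact: comparison_step.
move=> [g [f [s [hg hf hs]]]]; have [g' [f' [g'P f'P]]] := comparison_lift hg hf.
exists (s \+ (f' \o (h \o g)))%R => v /=.
by rewrite linearD /= f'P -hs -g'P hP subrK.
Qed.

End Transfer.

(** * Free resolutions by matrices *)

Section RowSpaces.
Variable R : comPzRingType.

Definition in_rows m n (A : 'M[R]_(m, n)) (v : 'rV[R]_n) : Prop :=
  exists w : 'rV[R]_m, v = w *m A.

Definition same_rows m m' n (A : 'M[R]_(m, n)) (B : 'M[R]_(m', n)) : Prop :=
  forall v, in_rows A v <-> in_rows B v.

Definition mx_exact k m n (B : 'M[R]_(k, m)) (A : 'M[R]_(m, n)) : Prop :=
  forall v : 'rV[R]_m, v *m A = 0 <-> in_rows B v.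

Lemma in_rows_mul m n k (A : 'M[R]_(m, n)) (B : 'M[R]_(k, n)) :
  (forall i, in_rows A (row i B)) -> exists C, B = C *m A.
Proof.
move=> /choice[w wP]; exists (\matrix_i w i).
by apply/row_matrixP => i; rewrite row_mul rowK wP.
Qed.

Lemma in_rows_row m n (A : 'M[R]_(m, n)) i : in_rows A (row i A).
Proof. by exists (delta_mx 0 i); rewrite rowE. Qed.

Lemma same_rows_factor m m' n (A : 'M[R]_(m, n)) (B : 'M[R]_(m', n)) :
  same_rows A B -> exists C, A = C *m B.
Proof. by move=> AB; apply: in_rows_mul => i; apply/AB/in_rows_row. Qed.

Lemma mx_exact_mul0 k m n (B : 'M[R]_(k, m)) (A : 'M[R]_(m, n)) :
  mx_exact B A -> B *m A = 0.
Proof.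
move=> ex; apply/row_matrixP => i; rewrite row_mul row0.
exact/ex/in_rows_row.
Qed.

Lemma mx_exact_factor k m n p (B : 'M[R]_(k, m)) (A : 'M[R]_(m, n)) (C : 'M[R]_(p, m)) :
  mx_exact B A -> C *m A = 0 -> exists X, C = X *m B.
Proof.
by move=> ex CA; apply: in_rows_mul => i; apply/ex; rewrite -row_mul CA row0.
Qed.

Lemma mx_exact_same_rows k m m' n (B : 'M[R]_(k, m)) (A : 'M[R]_(m, n))
    (A' : 'M[R]_(m', n)) : same_rows A A' -> mx_exact B A ->
  exists k' (B' : 'M[R]_(k', m')), mx_exact B' A'.
Proof.
move=> AA' ex; have [C AC] := same_rows_factor AA'.
have [C' AC'] : exists C', A' = C' *m A.
  by apply: same_rows_factor => v; split=> /AA'.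
(* The relations on [A'] come from rewriting its rows through [A] and back, [1 - C' C], and from the
   relations [B] on [A] expressed through [A']. *)
exists (m' + k)%N, (col_mx (1%:M - C' *m C) (B *m C)) => v; split=> [vA|[w ->]].
  have /ex[w wP] : v *m C' *m A = 0 by rewrite -mulmxA -AC'.
  exists (row_mx v w); rewrite mul_row_col mulmxBr mulmx1 !mulmxA -wP.
  by rewrite subrK.
rewrite -mulmxA mul_col_mx mulmxBl mul1mx -!mulmxA -AC (mx_exact_mul0 ex).
by rewrite -AC' subrr col_mx0 mulmx0.
Qed.

Definition kernels_fg : Prop :=
  forall m n (A : 'M[R]_(m, n)), exists k (B : 'M[R]_(k, m)), mx_exact B A.

Lemma ideal_gen_rows m (a : 'cV[R]_m) (v : 'rV[R]_1) :
  ideal_gen (fun i => a i 0) (v 0 0) <-> in_rows a v.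
Proof.
split=> [[c vE]|[w ->]]; last by exists (fun i => w 0 i); rewrite mxE.
exists (\row_i c i); apply/rowP => j; rewrite ord1 vE mxE.
by apply: eq_bigr => i _; rewrite mxE.
Qed.

Lemma mx11_eq0 (v : 'rV[R]_1) : v = 0 <-> v 0 0 = 0.
Proof.
by split=> [->|v0]; rewrite ?mxE //; apply/rowP => j; rewrite ord1 v0 mxE.
Qed.

(** Coherence presents the ideal on generators of its own choosing; [mx_exact_same_rows] moves the
    relations to the given ones. *)
Lemma coherent_kernel_col m (a : 'cV[R]_m) : coherent R ->
  exists k (B : 'M[R]_(k, m)), mx_exact B a.
Proof.
move=> coh; have [|n [b [k [B [bP BP]]]]] := coh (ideal_gen (fun i => a i 0)).
  by exists m, (fun i => a i 0).
apply: (@mx_exact_same_rows k n m 1 (\matrix_(i, j) B i j) (\col_i b i)).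
  move=> v; rewrite -!ideal_gen_rows bP.
  have -> : (fun i => (\col_i b i) i 0) = b by apply/funext => i; rewrite mxE.
  by [].
move=> v; have <- : \sum_(j < n) v 0 j * b j = 0 <-> v *m \col_i b i = 0.
  rewrite mx11_eq0 mxE; under [in X in _ <-> X]eq_bigr do rewrite mxE.
  by [].
rewrite BP; split=> [[c cP]|[w ->]].
  exists (\row_i c i); apply/rowP => j; rewrite cP mxE.
  by apply: eq_bigr => l _; rewrite !mxE.
by exists (fun i => w 0 i) => j; rewrite mxE; apply: eq_bigr => l _; rewrite mxE.
Qed.

(** Induction on the number of columns: inside the kernel [B] of all columns but the first, the
    first column imposes a one-column condition [B *m lsubmx A]. *)
Lemma coherent_kernels_fg : coherent R -> kernels_fg.
Proof.
move=> coh m; elim=> [|n IHn] A.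
  exists m, 1%:M => v; split=> [_|_]; first by exists v; rewrite mulmx1.
  by rewrite thinmx0.
move: A; rewrite -[n.+1]/(1 + n)%N => A; have [k [B BP]] := IHn (rsubmx A).
have [l [C CP]] := coherent_kernel_col (B *m lsubmx A) coh.
exists l, (C *m B) => v.
have -> : v *m A = row_mx (v *m lsubmx A) (v *m rsubmx A).
  by rewrite -mul_mx_row hsubmxK.
split=> [/eqP|[w ->]].
  rewrite row_mx_eq0 => /andP[/eqP vl /eqP /BP[w vE]].
  have /CP[u uP] : w *m (B *m lsubmx A) = 0 by rewrite mulmxA -vE.
  by exists u; rewrite vE uP mulmxA.
apply/eqP; rewrite row_mx_eq0 -!mulmxA (mx_exact_mul0 BP) !mulmx0 eqxx andbT.
by rewrite (mx_exact_mul0 CP) mulmx0.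
Qed.

(* [b] is the rank of the module in degree [0], [n i] that in degree [i.+1]. *)
Definition rk (b : nat) (n : nat -> nat) (i : nat) : nat := if i is j.+1 then n j else b.

Definition free_res b n (D : forall i, 'M[R]_(n i, rk b n i)) : Prop :=
  forall i, mx_exact (D i.+1) (D i).

Section Resolution.
Variable Q : forall m n, 'M[R]_(m, n) -> Prop.
Hypothesis stepQ : forall m n (A : 'M[R]_(m, n)), Q A ->
  exists k (B : 'M[R]_(k, m)), mx_exact B A /\ Q B.

(** [Q] is an invariant carried along the construction: trivial for an arbitrary resolution,
    [minimal_rows] for a minimal one. *)
Lemma free_res_exists m b (A : 'M[R]_(m, b)) : Q A ->
  exists n (D : forall i, 'M[R]_(n i, rk b n i)),
    [/\ free_res D, same_rows (D 0%N) A & forall i, Q (D i)].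
Proof.
move=> QA.
pose state := {a : nat & {c : nat & {X : 'M[R]_(a, c) | Q X}}}.
pose st0 : state := existT _ m (existT _ b (exist _ A QA)).
pose mat (s : state) : 'M[R]_(tag s, tag (tagged s)) := sval (tagged (tagged s)).
have matQ s : Q (mat s) := svalP (tagged (tagged s)).
have nextP (s : state) :
    {kB : {k : nat & {B : 'M[R]_(k, tag s) | Q B}} | mx_exact (sval (tagged kB)) (mat s)}.
  apply: cid; have [k [B [ex QB]]] := stepQ (matQ s).
  by exists (existT _ k (exist _ B QB)).
pose next (s : state) : state :=
  existT _ (tag (sval (nextP s))) (existT _ (tag s) (tagged (sval (nextP s)))).
pose st := fix st i := if i is j.+1 then next (st j) else st0.
pose n i := tag (st i).
pose D i : 'M[R]_(n i, rk b n i) :=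
  match i return 'M[R]_(n i, rk b n i) with 0 => mat st0 | j.+1 => mat (st j.+1) end.
exists n, D; split.
- case=> [|i]; [exact: (svalP (nextP st0)) | exact: (svalP (nextP (st i.+1)))].
- by [].
- by case=> [|i]; [exact: (matQ st0) | exact: (matQ (st i.+1))].
Qed.
End Resolution.

(** The last condition stands in for finite projective dimension: it makes the image of [D k] a
    direct summand of a free module, with idempotent projection [H *m D k]. *)
Definition finite_free_res : Prop := forall m (a : 'cV[R]_m),
  exists n (D : forall i, 'M[R]_(n i, rk 1 n i)),
  [/\ free_res D, same_rows (D 0%N) a & exists k H, D k *m H *m D k = D k].

Definition row11 (r : R^o) : 'rV[R]_1 := const_mx r.
Fact row11_linear : linear row11.
Proof. by move=> a x y; apply/rowP => i; rewrite !mxE. Qed.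
HB.instance Definition _ := GRing.isLinear.Build R R^o 'rV[R]_1 _ row11 row11_linear.

Definition entry11 (v : 'rV[R]_1) : R^o := v 0 0.
Fact entry11_linear : linear entry11.
Proof. by move=> a x y; rewrite /entry11 !mxE. Qed.
HB.instance Definition _ := GRing.isLinear.Build R 'rV[R]_1 R^o _ entry11 entry11_linear.

Lemma entry11K : cancel entry11 row11.
Proof. by move=> v; apply/rowP => i; rewrite mxE ord1. Qed.

Lemma coherent_regular_finite_free_res : coherent R -> regular_ring R -> finite_free_res.
Proof.
move=> coh reg m a; have ker := coherent_kernels_fg coh.
have [k l A _|n [D [Dres Da _]]] := @free_res_exists (fun _ _ _ => True) _ m 1 a I.
  by have [k' [B BP]] := ker _ _ A; exists k', B.
exists n, D; split=> //.
have [|N [P [d [d0 [prP [vanP [imP [exP0 exP]]]]]]]] := reg (ideal_gen (fun i => a i 0)).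
  by exists m, (fun i => a i 0).
(* The augmentation [d0] is prepended as differential of degree 0, so that both complexes start with
   a free module of rank 1. *)
pose P' i : lmodType R := if i is j.+1 then P j else R^o.
pose d' i : {linear P' i.+1 -> P' i} :=
  match i return {linear P' i.+1 -> P' i} with 0 => d0 | j.+1 => d j end.
pose Q i : lmodType R := 'rV[R]_(rk 1 n i).
pose e i : {linear Q i.+1 -> Q i} := mulmxr (D i).
have exP' i (v : P' i.+1) : d' i v = 0 <-> exists w, d' i.+1 w = v.
  by case: i v => [|i] v; [exact: exP0 | exact: exP].
have exQ i (v : Q i.+1) : e i v = 0 <-> exists w, e i.+1 w = v.
  by rewrite /= [_ = 0]Dres; split=> -[w wP]; exists w; rewrite wP.
have cmp : comparison d' e 0.
  exists entry11, row11, (\0)%R; split=> v.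
  - by apply/imP/(ideal_gen_rows a (v *m D 0%N))/Da; exists v.
  - have : ideal_gen (fun i => a i 0) ((row11 (d0 v)) 0 0).
      by rewrite mxE; apply/imP; exists v.
    by move=> /ideal_gen_rows/Da[w wP]; exists w.
  - have -> : e 0 ((\0 : {linear _ -> _})%R (e 0 v)) = 0 by exact: linear0.
    by apply/eqP; rewrite subr_eq0 eq_sym; apply/eqP/entry11K.
(* The target of [d' N.+2] is [P N.+1], which is zero, so the zero map serves as [h]. *)
have [|||s sP] := @von_neumann_transfer _ P' Q d' e _ _ exP' exQ N.+2 \0%R cmp.
- by move=> i; exact: prP.
- by move=> i; exact: rV_projective.
- by move=> v; rewrite [LHS]vanP // [RHS]vanP.
exists N.+2, (lin1_mx s); apply/row_matrixP => i; rewrite !row_mul.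
by rewrite mul_rV_lin1; have := sP (delta_mx 0 i); rewrite /e /= -rowE.
Qed.

End RowSpaces.

(** Both complexes resolve the quotient by the same submodule, so identities in degree 0 start a
    comparison and the condition is independent of the resolution. *)
Lemma von_neumann_mx (R : comPzRingType) b n n' (D : forall i, 'M[R]_(n i, rk b n i))
    (D' : forall i, 'M[R]_(n' i, rk b n' i)) k H :
  free_res D -> free_res D' -> same_rows (D 0%N) (D' 0%N) ->
  D k *m H *m D k = D k -> exists H', D' k *m H' *m D' k = D' k.
Proof.
move=> Dres D'res DD' HP.
pose P i : lmodType R := 'rV[R]_(rk b n i).
pose Q i : lmodType R := 'rV[R]_(rk b n' i).
pose d i : {linear P i.+1 -> P i} := mulmxr (D i).
pose e i : {linear Q i.+1 -> Q i} := mulmxr (D' i).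
have exP i (v : P i.+1) : d i v = 0 <-> exists w, d i.+1 w = v.
  by rewrite /= [_ = 0]Dres; split=> -[w wP]; exists w; rewrite wP.
have exQ i (v : Q i.+1) : e i v = 0 <-> exists w, e i.+1 w = v.
  by rewrite /= [_ = 0]D'res; split=> -[w wP]; exists w; rewrite wP.
have cmp : comparison d e 0.
  exists idfun, idfun, (\0)%R; split=> v.
  - have /DD'[w wP] : in_rows (D' 0%N) (v *m D' 0%N) by exists v.
    by exists w; rewrite /= -wP.
  - have /DD'[w wP] : in_rows (D 0%N) (v *m D 0%N) by exists v.
    by exists w; rewrite /= -wP.
  - have -> : e 0 ((\0 : {linear _ -> _})%R (e 0 v)) = 0 by exact: linear0.
    by rewrite subrr.
pose h : {linear P k -> P k.+1} := mulmxr H.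
have [|||s sP] := @von_neumann_transfer _ P Q d e _ _ exP exQ k h cmp.
- by move=> i; exact: rV_projective.
- by move=> i; exact: rV_projective.
- by move=> v; have := congr1 (mulmx v) HP; rewrite !mulmxA.
exists (lin1_mx s); apply/row_matrixP => i; rewrite !row_mul.
by rewrite mul_rV_lin1; have := sP (delta_mx 0 i); rewrite /e /= -rowE.
Qed.

(** * Localization of matrices, exactness and resolutions *)

Section LocalizedMatrices.
Variables (R S : comPzRingType) (p : R -> Prop) (phi : {rmorphism R -> S}).
Hypotheses (pP : is_prime_ideal p) (phiP : is_localization_at p phi).

Lemma loc_unit s : ~ p s -> exists z, phi s * z = 1.
Proof. by case: phiP => h _; exact: h. Qed.

Lemma loc_unit_inj s (y z : S) : ~ p s -> phi s * y = phi s * z -> y = z.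
Proof.
move=> /loc_unit[t tP] e; rewrite -[y]mul1r -[z]mul1r -tP.
by rewrite ![phi s * t]mulrC -!mulrA e.
Qed.

Lemma prime_not1 : ~ p 1. Proof. by case: pP => _ []. Qed.

Lemma prime_compl_prod (I : Type) (r : seq I) (P : pred I) (s : I -> R) :
  (forall i, ~ p (s i)) -> ~ p (\prod_(i <- r | P i) s i).
Proof.
move=> sP; elim/big_rec: _ => [|i x _]; first exact: prime_not1.
exact: prime_compl_mul.
Qed.

Lemma common_denominator (I : finType) (y : I -> S) :
  exists s a, ~ p s /\ forall i, phi s * y i = phi (a i).
Proof.
have /choice[f fP] i : exists u : R * R, ~ p u.2 /\ y i * phi u.2 = phi u.1.
  by case: phiP => _ [h _]; have [a [s [ns e]]] := h (y i); exists (a, s).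
exists (\prod_i (f i).2), (fun i => (\prod_(j | j != i) (f j).2) * (f i).1).
split; first by apply: prime_compl_prod => i; have [] := fP i.
move=> i; rewrite (bigD1 i) //= !rmorphM /=; have [_ <-] := fP i.
by ring.
Qed.

Lemma common_annihilator (I : finType) (a : I -> R) : (forall i, phi (a i) = 0) ->
  exists s, ~ p s /\ forall i, s * a i = 0.
Proof.
move=> a0; have /choice[f fP] i : exists s, ~ p s /\ s * a i = 0.
  by case: phiP => _ [_ h]; exact: h.
exists (\prod_i f i); split; first by apply: prime_compl_prod => i; have [] := fP i.
move=> i; rewrite (bigD1 i) //= mulrC mulrA [a i * _]mulrC.
by have [_ ->] := fP i; rewrite mul0r.
Qed.

Lemma common_denominator_mx m n (A : 'M[S]_(m, n)) :
  exists s (B : 'M[R]_(m, n)), ~ p s /\ phi s *: A = map_mx phi B.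
Proof.
have [s [a [ns e]]] := common_denominator (fun ij : 'I_m * 'I_n => A ij.1 ij.2).
exists s, (\matrix_(i, j) a (i, j)); split=> //.
by apply/matrixP => i j; rewrite !mxE -e.
Qed.

Lemma common_annihilator_mx m n (A : 'M[R]_(m, n)) : map_mx phi A = 0 ->
  exists s, ~ p s /\ s *: A = 0.
Proof.
move=> /matrixP A0.
have [|s [ns e]] := common_annihilator (a := fun ij : 'I_m * 'I_n => A ij.1 ij.2).
  by move=> [i j]; have := A0 i j; rewrite !mxE.
by exists s; split=> //; apply/matrixP => i j; rewrite !mxE (e (i, j)).
Qed.

Lemma loc_unit_injmx m n s (A B : 'M[S]_(m, n)) : ~ p s ->
  phi s *: A = phi s *: B -> A = B.
Proof.
move=> ns /matrixP e; apply/matrixP => i j; apply: (loc_unit_inj ns).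
by have := e i j; rewrite !mxE.
Qed.

Lemma in_rows_scale m n s (A : 'M[S]_(m, n)) v : ~ p s ->
  in_rows A (phi s *: v) <-> in_rows A v.
Proof.
move=> ns; split=> [[w wP]|[w ->]]; last by exists (phi s *: w); rewrite scalemxAl.
have [z zP] := loc_unit ns; exists (z *: w).
by rewrite -scalemxAl -wP scalerA mulrC zP scale1r.
Qed.

Lemma same_rows_scale m n s (A : 'M[S]_(m, n)) : ~ p s -> same_rows (phi s *: A) A.
Proof.
move=> ns v; split=> -[w ->]; first by exists (phi s *: w); rewrite -scalemxAl scalemxAr.
have [z zP] := loc_unit ns; exists (z *: w).
by rewrite -scalemxAr -scalemxAl scalerA zP scale1r.
Qed.

(** Flatness of localization: [s] clears the denominators of [v], then [t] kills the product that
    vanishes only in [S], and exactness over [R] applies. *)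
Lemma loc_exact k m n (B : 'M[R]_(k, m)) (A : 'M[R]_(m, n)) :
  mx_exact B A -> mx_exact (map_mx phi B) (map_mx phi A).
Proof.
move=> ex v; split=> [vA|[w ->]]; last first.
  by rewrite -mulmxA -map_mxM (mx_exact_mul0 ex) map_mx0 mulmx0.
have [s [u [ns e]]] := common_denominator_mx v.
have [|t [nt tP]] := @common_annihilator_mx 1 n (u *m A).
  by rewrite map_mxM -e -scalemxAl vA scaler0.
have /ex[w wP] : (t *: u) *m A = 0 by rewrite -scalemxAl.
apply/(in_rows_scale _ _ ns)/(in_rows_scale _ _ nt); rewrite e; exists (map_mx phi w).
by rewrite -map_mxM -wP map_mxZ.
Qed.

Lemma loc_kernels_fg : kernels_fg R -> kernels_fg S.
Proof.
move=> ker m n A; have [s [B [ns e]]] := common_denominator_mx A.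
have [k [C exC]] := ker _ _ B; exists k, (map_mx phi C) => v.
rewrite -(loc_exact exC) -e -scalemxAr; split=> [->|]; first by rewrite scaler0.
by rewrite -[in X in X -> _](scaler0 _ (phi s)) => /(loc_unit_injmx ns).
Qed.

Lemma loc_finite_free_res : finite_free_res R -> finite_free_res S.
Proof.
move=> res m a; have [s [b [ns e]]] := common_denominator_mx a.
have [n [D [Dres Db [k [H HP]]]]] := res m b.
exists n, (fun i => map_mx phi (D i)); split.
- by move=> i; exact: loc_exact.
- move=> v; rewrite -(same_rows_scale a ns) e.
  have [C CP] := same_rows_factor Db; have [C' C'P] : exists C', b = C' *m D 0%N.
    by apply: same_rows_factor => u; split=> /Db.
  split=> -[w ->]; first by exists (w *m map_mx phi C); rewrite CP map_mxM mulmxA.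
  by exists (w *m map_mx phi C'); rewrite C'P map_mxM mulmxA.
- by exists k, (map_mx phi H); rewrite -!map_mxM HP.
Qed.

End LocalizedMatrices.

(** * Minimal resolutions over a local ring *)

Section IdealEntries.
Variable R : comPzRingType.

Definition entries_in (I : R -> Prop) m n (A : 'M[R]_(m, n)) : Prop := forall i j, I (A i j).

Variable I : R -> Prop.
Hypothesis iI : is_ideal I.

Lemma ideal_sum (J : Type) (r : seq J) (P : pred J) (F : J -> R) :
  (forall j, I (F j)) -> I (\sum_(j <- r | P j) F j).
Proof.
case: iI => I0 [ID _] FI; elim/big_rec: _ => [//|j y _]; exact: ID.
Qed.

Lemma idealM r a : I a -> I (r * a). Proof. by case: iI => _ [_]; apply. Qed.

Lemma entries_mull k m n (B : 'M[R]_(k, m)) (A : 'M[R]_(m, n)) :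
  entries_in I A -> entries_in I (B *m A).
Proof. by move=> AI i j; rewrite mxE; apply: ideal_sum => l; exact: idealM. Qed.

Lemma entries_mulr k m n (B : 'M[R]_(k, m)) (A : 'M[R]_(m, n)) :
  entries_in I B -> entries_in I (B *m A).
Proof.
by move=> BI i j; rewrite mxE; apply: ideal_sum => l; rewrite mulrC; exact: idealM.
Qed.

Lemma entriesD m n (A B : 'M[R]_(m, n)) :
  entries_in I A -> entries_in I B -> entries_in I (A + B).
Proof. by move=> AI BI i j; rewrite mxE; case: iI => _ [h _]; exact: h. Qed.

Lemma entriesN m n (A : 'M[R]_(m, n)) : entries_in I A -> entries_in I (- A).
Proof. by move=> AI i j; rewrite mxE -mulN1r; exact: idealM. Qed.

End IdealEntries.

(** Recursive form of the ideal generated by [x 0, ..., x l.-1], suited to inductions that treat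
    [x l] modulo the earlier terms. *)
Fixpoint initial_ideal (R : comPzRingType) (x : nat -> R) (l : nat) (r : R) : Prop :=
  if l is k.+1 then exists c, initial_ideal x k (r - c * x k) else r = 0.

Lemma initial_idealP (R : comPzRingType) (x : nat -> R) l : is_ideal (initial_ideal x l).
Proof.
elim: l => [|l [I0 [ID IM]]] /=.
  by split=> //; split=> [a b -> ->|r a ->]; rewrite ?addr0 ?mulr0.
split; first by exists 0; rewrite mul0r subr0.
split=> [a b [c ca] [d db]|r a [c ca]].
  by exists (c + d); rewrite mulrDl opprD addrACA; exact: ID.
by exists (r * c); rewrite -mulrA -mulrBr; exact: IM.
Qed.

Lemma initial_ideal_mem (R : comPzRingType) (x : nat -> R) l j :
  (j < l)%N -> initial_ideal x l (x j).
Proof.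
elim: l => // l IHl; have [I0 _] := initial_idealP x l.
rewrite ltnS leq_eqVlt => /orP[/eqP->|/IHl Ij] /=; first by exists 1; rewrite mul1r subrr.
by exists 0; rewrite mul0r subr0.
Qed.

Section LocalRing.
Variables (T : comPzRingType) (m : T -> Prop).
Hypotheses (mI : is_ideal m) (m1 : ~ m 1).
Hypothesis mU : forall y, ~ m y -> exists z, y * z = 1.

(** A relation with a unit coefficient would make a row redundant, so this is minimality of the rows
    as generators. *)
Definition minimal_rows k n (A : 'M[T]_(k, n)) : Prop :=
  forall v : 'rV[T]_k, v *m A = 0 -> entries_in m v.

Lemma same_rows_drop k n (A : 'M[T]_(k.+1, n)) (v : 'rV[T]_k.+1) i z :
  v *m A = 0 -> v 0 i * z = 1 -> same_rows (row' i A) A.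
Proof.
move=> vA vz u; split=> -[c ->].
  by exists (c *m row' i 1%:M); rewrite -mulmxA !row'Esub -rowsubE.
(* Subtracting a multiple of the relation [v] removes the coefficient of row [i]. *)
pose c' := c - (c 0 i * z) *: v.
have c'i : c' 0 i = 0 by rewrite !mxE -mulrA [z * _]mulrC vz mulr1 subrr.
have -> : c *m A = c' *m A by rewrite mulmxBl -scalemxAl vA scaler0 subr0.
exists (col' i c'); apply/rowP => j; rewrite !mxE (bigD1_ord i) //= c'i mul0r add0r.
by apply: eq_bigr => l _; rewrite !mxE.
Qed.

Lemma minimal_rows_exist k n (A : 'M[T]_(k, n)) :
  exists k' (B : 'M[T]_(k', n)), same_rows B A /\ minimal_rows B.
Proof.
elim: k A => [|k IHk] A; first by exists 0, A; split=> // v _ i [].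
have [Amin|] := pselect (minimal_rows A); first by exists k.+1, A.
move=> /existsNP[v /not_implyP[vA /existsNP[o /existsNP[i /mU[z vz]]]]].
have [k' [B [BA Bmin]]] := IHk (row' i A); exists k', B; split=> // u.
by rewrite BA; apply: (same_rows_drop vA (z := z)); rewrite -vz ord1.
Qed.

Lemma minimal_free_res k b (A : 'M[T]_(k, b)) : kernels_fg T ->
  exists n (D : forall i, 'M[T]_(n i, rk b n i)),
    [/\ free_res D, same_rows (D 0%N) A & forall i, minimal_rows (D i)].
Proof.
move=> ker; have [k' [B [BA Bmin]]] := minimal_rows_exist A.
have [||n [D [Dres DB Dmin]]] := @free_res_exists T minimal_rows _ k' b B.
- move=> p q C _; have [l [E exE]] := ker _ _ C.
  have [l' [F [FE Fmin]]] := minimal_rows_exist E.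
  by exists l', F; split=> // v; rewrite exE FE.
- by [].
by exists n, D; split=> // v; rewrite DB BA.
Qed.

Section MinimalResolution.
Variables (n : nat -> nat) (D : forall i, 'M[T]_(n i, rk 1 n i)).
Hypotheses (Dres : free_res D) (Dmin : forall i, minimal_rows (D i)).
Hypothesis D0m : entries_in m (D 0%N).

(** In positive degree the rows of [D i.+1] are relations on the minimal rows [D i]; degree 0 is
    [D0m]. *)
Lemma minimal_res_entries i : entries_in m (D i).
Proof.
case: i => [//|i] r c.
have /(Dmin (i := i)) h : row r (D i.+1) *m D i = 0 by apply/Dres/in_rows_row.
by have := h 0 c; rewrite mxE.
Qed.

(* [1 - D_k H] consists of relations on [D_k], so it is a multiple of [D_(k+1)];
   both it and [D_k H] then have entries in [m], which no diagonal entry allows. *)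
Lemma minimal_res_von_neumann k H : D k *m H *m D k = D k -> n k = 0%N.
Proof.
move=> HP; have h : (1%:M - D k *m H) *m D k = 0.
  by rewrite mulmxBl mul1mx HP subrr.
have [X XP] := mx_exact_factor (@Dres k) h.
apply/eqP; rewrite -leqn0 leqNgt; apply/negP => nk; apply: m1.
pose i0 := Ordinal nk.
have := entriesD mI (entries_mull (A := D k.+1) mI X (minimal_res_entries (i := _)))
                    (entries_mulr mI H (minimal_res_entries (i := k))) i0 i0.
by rewrite -XP subrK mxE eqxx.
Qed.

Lemma minimal_res_zero k j : n k = 0%N -> n (k + j)%N = 0%N.
Proof.
move=> nk; elim: j => [|j IHj]; first by rewrite addn0.
(* A differential with zero module as target satisfies the condition with [H = 0]. *)
rewrite addnS; apply: (@minimal_res_von_neumann _ 0).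
have h : forall (p q : nat) (A : 'M[T]_(p, q)), q = 0%N -> A *m 0 *m A = A.
  by move=> p q A q0; subst q; apply/matrixP => ? [].
exact: h.
Qed.

Variable (x : nat -> T).
Local Notation I := (initial_ideal x).

(** This is the vanishing of Tor against the quotient by a regular sequence, in degrees above its
    length. In the inductive step [v *m D j.+1] is [x l] times some [W] modulo [I l]; regularity of
    [x l] makes [W] a cycle one degree lower, and subtracting [x l] times a lift of [W] turns [v]
    into a cycle modulo [I l]. *)
Lemma exact_mod_regular l : 
  (forall i y, (i < l)%N -> I i (x i * y) -> I i y) ->
  forall j (v : 'rV[T]_(n j)), (l <= j)%N -> entries_in (I l) (v *m D j) ->
  exists w, entries_in (I l) (v - w *m D j.+1).
Proof.
elim: l => [|l IHl] reg j v.
  move=> _ vD; have /Dres[w ->] : v *m D j = 0.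
    by apply/rowP => i; rewrite vD mxE.
  by exists w => i i'; rewrite subrr mxE.
have {}IHl := IHl (fun i y il => reg i y (leqW il)).
case: j v => // j v lj vD.
have /choice[f fP] i : exists c, I l ((v *m D j.+1) 0 i - c * x l) by exact: vD.
pose W : 'rV_(n j) := \row_i f i.
have iIl := initial_idealP x l.
have E : entries_in (I l) (v *m D j.+1 - x l *: W).
  by move=> i i'; rewrite ord1 !mxE [x l * _]mulrC; have := fP i'; rewrite mxE.
have WD : entries_in (I l) (W *m D j).
  move=> i i'; apply: reg => //; have := entries_mulr iIl (D j) (entriesN iIl E) i i'.
  rewrite opprB mulmxBl -mulmxA (mx_exact_mul0 (@Dres j)) mulmx0 subr0.
  by rewrite -scalemxAl mxE.
have [w' w'P] := IHl j W lj WD.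
have [|w wP] := IHl j.+1 (v - x l *: w') (leqW lj).
  have -> : (v - x l *: w') *m D j.+1 =
      (v *m D j.+1 - x l *: W) + (x l)%:M *m (W - w' *m D j.+1).
    by rewrite mul_scalar_mx scalerBr mulmxBl scalemxAl addrA subrK.
  by apply: (entriesD iIl) => //; exact: (entries_mull iIl).
exists w => i i' /=; exists (w' i i'); have := wP i i'; rewrite !mxE [x l * _]mulrC.
by rewrite addrAC.
Qed.

(** If only the next term vanishes, [D j] is injective modulo [I l] by [exact_mod_regular]. But a
    row of [D j] has entries in [m], so some [z] outside [I l] kills it modulo [I l], and [z] times
    a basis vector contradicts injectivity. *)
Lemma minimal_res_descend l j :
  (forall i y, (i < l)%N -> I i (x i * y) -> I i y) ->
  (forall k (r : 'I_k -> T), (forall i, m (r i)) ->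
     exists z, ~ I l z /\ forall i, I l (z * r i)) ->
  (l <= j)%N -> n j.+1 = 0%N -> n j = 0%N.
Proof.
move=> reg depth0 lj nj1; apply/eqP; rewrite -leqn0 leqNgt; apply/negP => nj.
pose i0 := Ordinal nj.
have [|z [zN zI]] := depth0 _ (fun i => D j i0 i).
  by move=> i; exact: minimal_res_entries.
have [|w wP] := @exact_mod_regular l reg j (z *: delta_mx 0 i0) lj.
  by move=> i i'; rewrite -scalemxAl -rowE !mxE.
apply: zN; have := wP 0 i0; have -> : w = 0.
  by apply/rowP => -[i ilt]; exfalso; move: ilt; rewrite /= nj1.
by rewrite mul0mx subr0 !mxE !eqxx mulr1.
Qed.
End MinimalResolution.

(* Auslander-Buchsbaum: a regular sequence of length [l] modulo which the depth
   is zero bounds the length of minimal resolutions. *)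
Lemma short_free_res (x : nat -> T) l k (a : 'cV[T]_k) :
  kernels_fg T -> finite_free_res T ->
  (forall i y, (i < l)%N -> initial_ideal x i (x i * y) -> initial_ideal x i y) ->
  (forall k (r : 'I_k -> T), (forall i, m (r i)) ->
     exists z, ~ initial_ideal x l z /\ forall i, initial_ideal x l (z * r i)) ->
  entries_in m a ->
  exists n (D : forall i, 'M[T]_(n i, rk 1 n i)),
    [/\ free_res D, same_rows (D 0%N) a & n l = 0%N].
Proof.
move=> ker res reg depth0 am; have [n [D [Dres Da Dmin]]] := minimal_free_res a ker.
exists n, D; split=> //.
have D0m : entries_in m (D 0%N).
  by have [C ->] := same_rows_factor Da; exact: entries_mull.
have [n' [D' [D'res D'a [t [H HP]]]]] := res _ a.
have [|H' H'P] := von_neumann_mx D'res Dres _ HP; first by move=> v; rewrite D'a Da.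
have nt := minimal_res_von_neumann Dres Dmin D0m H'P.
(* The zero term may lie below degree [l], so it is first pushed up to [l + t], from where the
   descent to [l] applies. *)
have : n (l + t)%N = 0%N by rewrite addnC; exact: minimal_res_zero Dres Dmin D0m _ _ nt.
elim: t {H HP H' H'P nt} => [|t IHt]; first by rewrite addn0.
rewrite addnS => /(minimal_res_descend Dres Dmin D0m reg depth0 (leq_addr _ _)).
exact: IHt.
Qed.

End LocalRing.

(** * The Koszul chase *)

Lemma sum_antisymmetric (V : zmodType) L (G : 'I_L -> 'I_L -> V) :
  (forall j, G j j = 0) -> (forall j k, G k j = - G j k) -> \sum_j \sum_k G j k = 0.
Proof.
move=> Gd Ga.
have -> : \sum_j \sum_k G j k =
    \sum_(j < L) \sum_(k : 'I_L | (j < k)%N) G j k + \sum_(j < L) \sum_(k : 'I_L | (k < j)%N) G j k.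
  rewrite -big_split; apply: eq_bigr => j _ /=.
  rewrite (bigID (fun k : 'I_L => (j < k)%N)) /=; congr (_ + _).
  rewrite (bigD1 j) ?ltnn //= Gd add0r; apply: eq_bigl => k.
  by rewrite -leqNgt ltn_neqAle andbC.
rewrite [X in _ + X](exchange_big_dep xpredT) //= -big_split big1 // => j _.
by rewrite -big_split big1 // => k _ /=; rewrite (Ga j k) subrr.
Qed.

Lemma rV0_eq (R : comPzRingType) n (u v : 'rV[R]_n) : n = 0%N -> u = v.
Proof. by move=> n0; subst n; rewrite [u]thinmx0 [v]thinmx0. Qed.

Section VectorKoszul.
Variables (R : comPzRingType) (L : nat).
Implicit Types (x : 'I_L -> R) (U : {set 'I_L}).

Definition ksign U (j : 'I_L) : R := (-1) ^+ #|[set k in U | (k < j)%N]|.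

(** Chains with vector values: [K(x)] tensored with a free module of rank [k], one row of the double
    complex. *)
Definition kdv k x (f : {set 'I_L} -> 'rV[R]_k) U : 'rV[R]_k :=
  \sum_(j < L | j \notin U) (ksign U j * x j) *: f (j |: U).

Definition ktrans m n x k (f : {set 'I_L} -> 'rV[R]_k) U : 'rV[R]_k :=
  (\prod_(j in U) x j ^+ (m - n)) *: f U.

Definition vhomog k i (f : {set 'I_L} -> 'rV[R]_k) : Prop :=
  forall U, #|U| != i -> f U = 0.

Definition kpow x n (j : 'I_L) : R := x j ^+ n.

Lemma kdv_coord k x (f : {set 'I_L} -> 'rV[R]_k) U c :
  kdv x f U 0 c = koszul_d x (fun V => f V 0 c) U.
Proof. by rewrite /kdv summxE; apply: eq_bigr => j _; rewrite mxE. Qed.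

Lemma kdv_mul k l x (f : {set 'I_L} -> 'rV[R]_k) (D : 'M_(k, l)) U :
  kdv x (fun V => f V *m D) U = kdv x f U *m D.
Proof. by rewrite /kdv mulmx_suml; apply: eq_bigr => j _; rewrite scalemxAl. Qed.

Lemma eq_kdv k x (f g : {set 'I_L} -> 'rV[R]_k) U : f =1 g -> kdv x f U = kdv x g U.
Proof. by move=> fg; apply: eq_bigr => j _; rewrite fg. Qed.

Lemma kdvB k x (f g : {set 'I_L} -> 'rV[R]_k) U :
  kdv x (fun V => f V - g V) U = kdv x f U - kdv x g U.
Proof. by rewrite /kdv -sumrB; apply: eq_bigr => j _; rewrite scalerBr. Qed.

Lemma kdv_homog k x i (f : {set 'I_L} -> 'rV[R]_k) : vhomog i.+1 f -> vhomog i (kdv x f).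
Proof.
move=> fh U Ui; apply: big1 => j jU; rewrite fh ?scaler0 //.
by rewrite cardsU1 jU add1n eqSS.
Qed.

Lemma ktrans_homog m n x k i (f : {set 'I_L} -> 'rV[R]_k) :
  vhomog i f -> vhomog i (ktrans m n x f).
Proof. by move=> fh U Ui; rewrite /ktrans fh ?scaler0. Qed.

Lemma ktrans_comp M m n x k (f : {set 'I_L} -> 'rV[R]_k) U : (n <= m <= M)%N ->
  ktrans m n x (ktrans M m x f) U = ktrans M n x f U.
Proof.
move=> /andP[nm mM]; rewrite /ktrans scalerA -big_split /=; congr (_ *: _).
by apply: eq_bigr => j _; rewrite -exprD addnC addnBA // subnK.
Qed.

Lemma kdv_ktrans m n x k (f : {set 'I_L} -> 'rV[R]_k) U : (n <= m)%N ->
  kdv (kpow x n) (ktrans m n x f) U = ktrans m n x (kdv (kpow x m) f) U.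
Proof.
move=> nm; rewrite /kdv [RHS]/ktrans scaler_sumr; apply: eq_bigr => j jU.
rewrite /ktrans !scalerA big_setU1 //=; congr (_ *: _).
by rewrite /kpow -[in X in _ = _ * (_ * X)](subnK nm) exprD; ring.
Qed.

Lemma ksignU1 U j k : j \notin U -> ksign (j |: U) k = (-1) ^+ (j < k)%N * ksign U k.
Proof.
move=> jU; rewrite /ksign -exprD; congr (_ ^+ _).
case: ltnP => jk; last first.
  apply: eq_card => i; rewrite !inE; case: eqVneq => //= ->.
  by rewrite ltnNge jk andbF.
rewrite (_ : [set _ in _ | _] = j |: [set i in U | (i < k)%N]).
  by rewrite cardsU1 inE (negPf jU).
by apply/setP => i; rewrite !inE; case: eqVneq => //= ->.
Qed.

Lemma kdv_kdv k x (f : {set 'I_L} -> 'rV[R]_k) U : kdv x (kdv x f) U = 0.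
Proof.
(* [G j i] is the contribution of [f (i |: (j |: U))] when [j] is removed last; the factor
   [(-1) ^+ (j < i)] makes it antisymmetric. *)
pose G j i := if [&& j \notin U, i \notin U & i != j] then
  (ksign U j * ksign U i * (-1) ^+ (j < i)%N * x j * x i) *: f (i |: (j |: U)) else 0.
rewrite -[RHS](@sum_antisymmetric _ _ G); last 2 first.
- by move=> j; rewrite /G eqxx !andbF.
- move=> j i; rewrite /G andbCA [j == i]eq_sym; case: ifP => [/and3P[_ _ ij]|]; last by rewrite oppr0.
  rewrite -scaleNr setUCA; congr (_ *: _).
  case: (ltngtP i j) => [_|_|/val_inj/eqP]; last by rewrite (negPf ij).
    by rewrite /= expr0 expr1; ring.
  by rewrite /= expr0 expr1; ring.
rewrite /kdv big_mkcond; apply: eq_bigr => j _; rewrite /G.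
case: ifP => jU /=; last by rewrite big1.
rewrite scaler_sumr big_mkcond; apply: eq_bigr => i _ /=.
rewrite !inE negb_or andbC; case: ifP => //= _; rewrite scalerA ksignU1 //.
by congr (_ *: _); ring.
Qed.

Lemma koszul_map_zero_vector m n i x k (f : {set 'I_L} -> 'rV[R]_k) :
  koszul_map_zero m n i x -> vhomog i f -> (forall U, kdv (kpow x m) f U = 0) ->
  exists w, vhomog i.+1 w /\ forall U, kdv (kpow x n) w U = ktrans m n x f U.
Proof.
move=> kz fh fd.
have /choice[w wP] (c : 'I_k) : exists w : {set 'I_L} -> R, homog i.+1 w /\
    koszul_d (kpow x n) w = koszul_trans m n x (fun U => f U 0 c).
  apply: kz => [U Ui|]; first by rewrite fh // mxE.
  by apply/funext => U; rewrite -[LHS]kdv_coord fd mxE.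
exists (fun U => \row_c w c U); split=> [U Ui|U]; apply/rowP => c.
  by rewrite !mxE; have [-> //] := wP c.
rewrite kdv_coord [RHS]mxE; have [_ /(congr1 (fun g => g U)) e] := wP c.
rewrite -[RHS]e; congr (koszul_d _ _ _).
by apply/funext => V; rewrite mxE.
Qed.

Definition kzero x m n : Prop := forall i, (1 <= i)%N -> koszul_map_zero m n i x.

(** A chain of [r] steps from exponent [n] up to [M], each killing Koszul homology in positive
    degrees; the chase uses one step per row. *)
Fixpoint kreach x r M n : Prop :=
  if r is r'.+1 then exists m, [/\ (n <= m)%N, kzero x m n & kreach x r' M m] else M = n.

Lemma kreach_le x r M n : kreach x r M n -> (n <= M)%N.
Proof.
elim: r n => [|r IHr] n /=; first by move=> ->.
by move=> [m [nm _ /IHr]]; exact: leq_trans.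
Qed.

Lemma kreach_exists x r n :
  (forall n, (0 < n)%N -> exists m, (n <= m)%N /\ kzero x m n) ->
  (0 < n)%N -> exists M, kreach x r M n.
Proof.
move=> wpr; elim: r n => [|r IHr] n n0; first by exists n.
have [m [nm mz]] := wpr n n0; have [M MP] := IHr m (leq_trans n0 nm).
by exists M, m.
Qed.

Variables (n : nat -> nat) (D : forall i, 'M[R]_(n i, rk 1 n i)).
Hypotheses (Dres : free_res D) (nL : rk 1 n L = 0%N).

(* A chase through the double complex [K (x) F], one transition of Koszul
   complexes being spent on each row. *)
Lemma koszul_chase x r i M N (c : {set 'I_L} -> 'rV[R]_(rk 1 n i)) :
  (i + r = L)%N -> kreach x r M N -> vhomog r c ->
  (forall U, in_rows (D i) (kdv (kpow x M) c U)) ->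
  exists b w, [/\ vhomog r b, vhomog r.+1 w &
    forall U, ktrans M N x c U = b U *m D i + kdv (kpow x N) w U].
Proof.
elim: r i N c => [|r IHr] i N c iL.
  (* Here [i = L], where the resolution vanishes by [nL], so any two vectors agree. *)
  move=> _ _ _; exists (fun=> 0), (fun=> 0); split=> [U _|U _|U] //.
  by apply: rV0_eq; move: nL; rewrite -iL addn0.
move=> [m [Nm mz mM]] ch cd.
have /choice[c0 c0P] U : exists u, kdv (kpow x M) c U = u *m D i by exact: cd.
(* The lifts are cut off outside degree [r], where the boundary of [c] vanishes. *)
pose c' U := if #|U| == r then c0 U else 0.
have c'h : vhomog r c' by move=> U Ur; rewrite /c' (negPf Ur).
have c'P U : kdv (kpow x M) c U = c' U *m D i.
  by rewrite /c'; case: ifPn => [_|Ur]; [exact: c0P | rewrite mul0mx (kdv_homog _ ch)].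
have [||b' [w' [b'h w'h bw]]] := IHr i.+1 m c' _ mM c'h.
- by rewrite addSnnS.
- move=> U; apply/Dres; rewrite -kdv_mul -[RHS](kdv_kdv (kpow x M) c U).
  by apply: eq_kdv => V; rewrite c'P.
(* By [bw], subtracting [w' D i] makes the image of [c] a Koszul cycle of positive degree [r.+1], so
   the transition from [m] to [N] turns it into a boundary. *)
pose f U := ktrans M m x c U - w' U *m D i.
have leM := kreach_le mM.
have [||w [wh wP]] := koszul_map_zero_vector (f := f) (mz r.+1 isT).
- move=> U Ur; rewrite /f (ktrans_homog _ _ _ ch) // w'h //.
  by rewrite mul0mx subrr.
- move=> U; rewrite kdvB kdv_mul kdv_ktrans // {1}/ktrans c'P scalemxAl -mulmxBl.
  have -> := bw U : (\prod_(j in U) x j ^+ (M - m)) *: c' U = _.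
  by rewrite addrK -mulmxA (mx_exact_mul0 (@Dres i)) mulmx0.
exists (ktrans m N x w'), w; split=> [|//|U]; first exact: ktrans_homog.
rewrite wP -(ktrans_comp (m := m)) ?Nm ?leM //.
by rewrite {1 2 4}/ktrans /f -scalemxAl -scalerDr addrC subrK.
Qed.

(** The chase starts from the top Koszul generator, whose boundary has coefficients in the ideal of
    the [x j ^+ M]. At [setT] the Koszul boundary is an empty sum, so only the part in the rows of
    [D 0] remains. *)
Lemma koszul_top_vanish x N M : kreach x L M N ->
  same_rows (D 0%N) (\col_j x j ^+ M) ->
  exists b : 'I_L -> R, \prod_j x j ^+ (M - N) = \sum_j b j * x j ^+ M.
Proof.
move=> reach Da; pose c U : 'rV[R]_1 := if U == setT then const_mx 1 else 0.
have [||b [w [_ _ bw]]] := @koszul_chase x L 0 M N c erefl reach.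
- move=> U Ur; rewrite /c; case: eqP => // UT; move: Ur.
  by rewrite UT cardsT card_ord eqxx.
- move=> U; apply/Da; exists (\row_j (if j \notin U then ksign U j * c (j |: U) 0 0 else 0)).
  apply/rowP => o; rewrite ord1 /kdv summxE mxE big_mkcond /=; apply: eq_bigr => j _.
  by rewrite !mxE; case: ifP => _; rewrite ?mul0r // ?mxE /kpow; ring.
have e := bw setT; rewrite [kdv _ w _]big_pred0 ?addr0 in e; last first.
  by move=> j; rewrite in_setT.
have /Da[v vP] : in_rows (D 0%N) (ktrans M N x c setT) by exists (b setT).
exists (v 0); move/rowP: vP => /(_ 0); rewrite !mxE /c eqxx mxE mulr1.
rewrite (eq_bigl xpredT) => [->|j]; last by rewrite inE.
by apply: eq_bigr => j _; rewrite mxE.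
Qed.

End VectorKoszul.

(** * Primes and localized sequences *)

(** The complement of [q] is a maximal multiplicative set [W] avoiding [J], given by Zorn's lemma.
    Enlarging [W] by powers of an outside element must meet [J], which is the last conclusion and
    makes [q] minimal over [J]. *)
Lemma minimal_prime_over (R : comPzRingType) (J : R -> Prop) : is_ideal J -> ~ J 1 ->
  exists q, [/\ is_prime_ideal q, forall r, J r -> q r &
    forall r, q r -> exists s t, ~ q s /\ J (s * r ^+ t)].
Proof.
move=> [J0 [JD JM]] J1.
pose P (W : R -> Prop) := (forall a b, W a -> W b -> W (a * b)) /\ forall a, W a -> ~ J a.
have [|W [[WM WJ] Wmax]] := @classical_sets.Zorn_bigcup R P.
  move=> F FP Ftot; split=> [a b [X FX Xa] [Y FY Yb]|a [X FX Xa]]; last first.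
    by have [_] := FP X FX; apply.
  have [XY|YX] := Ftot X Y FX FY.
    by exists Y => //; have [h _] := FP Y FY; apply: h => //; exact: XY.
  by exists X => //; have [h _] := FP X FX; apply: h => //; exact: YX.
have {}Wmax B : (forall a, W a -> B a) -> P B -> forall a, B a -> W a.
  move=> WB PB; apply: (@contrapT (forall a, B a -> W a)) => BW.
  suff lt : classical_sets.proper W B by exact: Wmax lt PB.
  by split.
(* [P] does not ask for 1, so that the empty chain has its union in [P]; maximality supplies 1. *)
have W1 : W 1.
  apply: (Wmax (fun a => W a \/ a = 1)); [by left| |by right].
  split=> [a b [Wa|->] [Wb|->]|a [|->] //]; rewrite ?mulr1 ?mul1r; try by [left|right].
    by left; exact: WM.
  exact: WJ.
have WX a t : W a -> W (a ^+ t).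
  by move=> Wa; elim: t => [|t IHt]; rewrite ?expr0 // exprS; exact: WM.
have meet r : ~ W r -> exists s t, W s /\ J (s * r ^+ t).
  move=> nr; apply: contrapT => h; apply: nr.
  apply: (Wmax (fun a => exists s t, W s /\ a = s * r ^+ t)).
  - by move=> a Wa; exists a, 0%N; rewrite mulr1.
  - split=> [_ _ [s [t [Ws ->]]] [s' [t' [Ws' ->]]]|_ [s [t [Ws ->]]] Jst].
      by exists (s * s'), (t + t')%N; rewrite exprD mulrACA; split=> //; exact: WM.
    by apply: h; exists s, t.
  - by exists 1, 1%N; rewrite mul1r expr1.
exists (fun r => ~ W r); split=> [|r Jr /WJ|r /meet[s [t [Ws Jst]]]] //; last first.
  by exists s, t; split.
have addW a b : ~ W a -> ~ W b -> ~ W (a + b).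
  move=> /meet[s [t [Ws Js]]] /meet[s' [t' [Ws' Js']]] Wab.
  apply: (WJ _ (WM _ _ (WM _ _ Ws Ws') (WX _ (t + t')%N Wab))).
  (* In each binomial term either [a] has exponent at least [t] or [b] has exponent at least
     [t']. *)
  rewrite exprDn mulr_sumr; elim/big_rec: _ => [//|[j jlt] y _ Jy]; apply: JD => //=.
  case: (leqP t (t + t' - j)) => tj; rewrite mulrnAr -mulr_natl.
    rewrite -(subnK tj) exprD.
    have -> : forall u v : R, s * s' * (u * a ^+ t * v) = (u * v * s') * (s * a ^+ t).
      by move=> *; ring.
    by apply/JM/JM.
  have {}tj : (t' <= j)%N by lia.
  rewrite -(subnK tj) exprD.
  have -> : forall u v : R, s * s' * (v * (u * b ^+ t')) = (u * v * s) * (s' * b ^+ t').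
    by move=> *; ring.
  by apply/JM/JM.
split; [split; [|split]|split] => //.
- by move=> /WJ.
- move=> r a /meet[s [t [Ws Js]]] Wra; apply: (WJ _ (WM _ _ Ws (WX _ t Wra))).
  by rewrite exprMn mulrCA; exact: JM.
- by move=> a b nab; apply: contrapT => /not_orP[/contrapT Wa /contrapT Wb]; apply/nab/WM.
Qed.

Section KoszulScalars.
Variables (R : comPzRingType) (L : nat) (x : 'I_L -> R).

Lemma koszul_d_scale c f U : koszul_d x (fun V => c * f V) U = c * koszul_d x f U.
Proof. by rewrite /koszul_d mulr_sumr; apply: eq_bigr => j _; rewrite mulrCA. Qed.

Lemma koszul_d_morph (S : comPzRingType) (psi : {rmorphism R -> S}) f U :
  psi (koszul_d x f U) = koszul_d (psi \o x) (psi \o f) U.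
Proof.
rewrite /koszul_d rmorph_sum; apply: eq_bigr => j _.
by rewrite !rmorphM rmorphXn rmorphN1.
Qed.
End KoszulScalars.

Section LocalizedSequences.
Variables (S T : comPzRingType) (q : S -> Prop) (psi : {rmorphism S -> T}).
Hypotheses (qP : is_prime_ideal q) (psiP : is_localization_at q psi).

(** The element [s] clears the denominators of the cycle, [t] kills its boundary over [S], and the
    bounding chain is divided by [s * t]. *)
Lemma loc_koszul_map_zero L m n i (x : 'I_L -> S) :
  koszul_map_zero m n i x -> koszul_map_zero m n i (psi \o x).
Proof.
move=> kz z zh zd; have [s [a [ns sa]]] := common_denominator qP psiP z.
(* Off degree [i] only the images [psi (a U)] are known to vanish; the cut-off makes the chain
   homogeneous over [S]. *)
pose a' (U : {set 'I_L}) := if #|U| == i then a U else 0.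
have sa' U : psi s * z U = psi (a' U).
  by rewrite /a' sa; case: ifPn => // Ui; rewrite -sa zh // mulr0 rmorph0.
have xX e : (fun j => (psi \o x) j ^+ e) = psi \o (fun j => x j ^+ e).
  by apply/funext => j /=; rewrite rmorphXn.
have [|t [nt ta]] := common_annihilator qP psiP (a := koszul_d (fun j => x j ^+ m) a').
  move=> U; rewrite koszul_d_morph -xX.
  have -> : psi \o a' = fun U => psi s * z U by apply/funext => V; rewrite /= sa'.
  by rewrite koszul_d_scale zd mulr0.
have [||w [wh wd]] := kz (fun U => t * a' U).
- by move=> U Ui; rewrite /a' (negPf Ui) mulr0.
- by apply/funext => U; rewrite koszul_d_scale ta.
have [v vP] := loc_unit psiP (prime_compl_mul qP ns nt).
exists (fun U => v * psi (w U)); split=> [U Ui|]; first by rewrite wh // rmorph0 mulr0.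
apply/funext => U; rewrite koszul_d_scale xX -(koszul_d_morph _ psi) wd /koszul_trans.
rewrite !rmorphM -sa' rmorph_prod mulrCA; under eq_bigr do rewrite rmorphXn.
by congr (_ * _); rewrite -[RHS]mul1r -vP rmorphM; ring.
Qed.

Variable x : nat -> S.

Lemma initial_ideal_morph l r : initial_ideal x l r -> initial_ideal (psi \o x) l (psi r).
Proof.
elim: l r => [|l IHl] r /=; first by move=> ->; rewrite rmorph0.
by move=> [c /IHl]; rewrite rmorphB rmorphM; exists (psi c).
Qed.

Lemma initial_ideal_loc l y : initial_ideal (psi \o x) l y ->
  exists s r, [/\ ~ q s, psi s * y = psi r & initial_ideal x l r].
Proof.
elim: l y => [|l IHl] y /=.
  by move=> ->; exists 1, 0; rewrite mulr0 rmorph0; split=> //; exact: prime_not1 qP.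
move=> [c /IHl[s [r [ns e Ir]]]]; have [_ [den _]] := psiP.
have [c0 [u [nu ce]]] := den c.
exists (u * s), (u * r + s * c0 * x l); split; first exact: prime_compl_mul.
  rewrite !(rmorphM, rmorphD) -e -ce; ring.
by exists (s * c0); rewrite addrK; have [_ [_]] := initial_idealP x l; apply.
Qed.

Lemma initial_ideal_loc_morph l r : initial_ideal (psi \o x) l (psi r) ->
  exists s, ~ q s /\ initial_ideal x l (s * r).
Proof.
move=> /initial_ideal_loc[s [r' [ns e Ir]]]; have [_ [_ ann]] := psiP.
have [|t [nt te]] := ann (s * r - r'); first by rewrite rmorphB rmorphM e subrr.
exists (t * s); split; first exact: prime_compl_mul.
move/eqP: te; rewrite mulrBr subr_eq0 mulrA => /eqP->.
by have [_ [_]] := initial_idealP x l; apply.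
Qed.

Lemma initial_ideal_unit l s y : ~ q s ->
  initial_ideal (psi \o x) l (psi s * y) -> initial_ideal (psi \o x) l y.
Proof.
move=> ns; have [z zP] := loc_unit psiP ns.
have [_ [_ IM]] := initial_idealP (psi \o x) l.
by move=> /(IM z); rewrite mulrA [z * _]mulrC zP mul1r.
Qed.

Lemma regular_loc l : (forall y, initial_ideal x l (x l * y) -> initial_ideal x l y) ->
  forall y, initial_ideal (psi \o x) l (psi (x l) * y) -> initial_ideal (psi \o x) l y.
Proof.
move=> reg y Iy; have [_ [den _]] := psiP; have [a [s [ns e]]] := den y.
apply: (initial_ideal_unit ns); rewrite mulrC e.
have [|t [nt It]] := @initial_ideal_loc_morph l (x l * a).
  rewrite rmorphM -e mulrA mulrC; have [_ [_]] := initial_idealP (psi \o x) l; exact.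
apply: (initial_ideal_unit nt); rewrite -rmorphM; apply: initial_ideal_morph.
by apply: reg; rewrite mulrCA.
Qed.

(** The extension of [q], which is the maximal ideal of [T]. *)
Definition loc_max (y : T) : Prop := exists a s, [/\ q a, ~ q s & y * psi s = psi a].

Lemma loc_max_ideal : is_ideal loc_max.
Proof.
have [[q0 [qD qM]] _] := qP; split; [|split].
- by exists 0, 1; rewrite mul0r rmorph0; split=> //; exact: prime_not1 qP.
- move=> y z [a [s [qa ns ya]]] [b [t [qb nt zb]]]; exists (t * a + s * b), (s * t).
  split; [by apply: qD; apply: qM | exact: prime_compl_mul|].
  by rewrite !(rmorphM, rmorphD) -ya -zb; ring.
- move=> c y [a [s [qa ns ya]]]; have [_ [den _]] := psiP; have [b [t [nt cb]]] := den c.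
  exists (b * a), (t * s); split; [exact: qM | exact: prime_compl_mul |].
  by rewrite !rmorphM -ya -cb; ring.
Qed.

Lemma loc_max_proper : ~ loc_max 1.
Proof.
move=> [a [s [qa ns]]]; rewrite mul1r => e; have [_ [_ ann]] := psiP.
have [|t [nt te]] := ann (s - a); first by rewrite rmorphB e subrr.
have [[q0 [qD qM]] _] := qP; apply: (prime_compl_mul qP nt ns).
by move/eqP: te; rewrite mulrBr subr_eq0 => /eqP->; exact: qM.
Qed.

Lemma loc_max_unit y : ~ loc_max y -> exists z, y * z = 1.
Proof.
move=> ny; have [_ [den _]] := psiP; have [a [s [ns e]]] := den y.
have [|z zP] := @loc_unit _ _ _ _ psiP a; first by move=> qa; apply: ny; exists a, s.
by exists (psi s * z); rewrite mulrA e.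
Qed.

End LocalizedSequences.

(** For each [r i] in turn, the element is multiplied by the highest power of [r i] that keeps it
    outside [I]; products already in [I] stay there. *)
Lemma socle_of_nilpotent (R : comPzRingType) (I : R -> Prop) (y : R) k (r : 'I_k -> R) :
  is_ideal I -> ~ I y -> (forall i, exists t, I (r i ^+ t * y)) ->
  exists c, ~ I (c * y) /\ forall i, I (c * y * r i).
Proof.
move=> iI ny; elim: k r => [|k IHk] r rn; first by exists 1; rewrite mul1r; split=> // -[].
have [c [nc cP]] := IHk (fun i => r (lift ord0 i)) (fun i => rn (lift ord0 i)).
have ex : exists t, `[< I (r ord0 ^+ t * (c * y)) >].
  have [t tP] := rn ord0; exists t; apply/asboolP; rewrite mulrCA; exact: idealM.
have [t /asboolP tP tmin] := ex_minnP ex.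
case: t tP tmin => [|t] tP tmin; first by move: tP; rewrite mul1r.
exists (r ord0 ^+ t * c); rewrite -mulrA; split=> [h|i].
  by have /tmin := introT (asboolP _) h; rewrite ltnn.
case: (unliftP ord0 i) => [j ->|->]; first by rewrite -mulrA; exact: idealM.
by move: tP; congr (I _); rewrite exprS; ring.
Qed.

Lemma ideal_seq_rcons (R : comPzRingType) (s : seq R) a r :
  ideal_seq (rcons s a) r <-> exists c, ideal_seq s (r - c * a).
Proof.
have nthr (i : 'I_(size s)) : (rcons s a)`_i = s`_i by rewrite nth_rcons ltn_ord.
have nthl : (rcons s a)`_(size s) = a by rewrite nth_rcons ltnn eqxx.
rewrite /ideal_seq size_rcons; split=> [[c ->]|[e [c cP]]].
  exists (c ord_max), (fun i => c (widen_ord (leqnSn _) i)).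
  rewrite big_ord_recr /= nthl addrK; apply: eq_bigr => i _.
  by rewrite nthr.
exists (fun i => if unlift ord_max i is Some j then c j else e).
rewrite big_ord_recr /= nthl unlift_none -[LHS](subrK (e * a)) cP; congr (_ + _).
apply: eq_bigr => i _; rewrite nthr.
have -> : widen_ord (leqnSn (size s)) i = lift ord_max i by apply: ord_inj; rewrite lift_max.
by rewrite liftK.
Qed.

Lemma ideal_seq_take (R : comPzRingType) (s : seq R) i r : (i <= size s)%N ->
  ideal_seq (take i s) r <-> initial_ideal (nth 0 s) i r.
Proof.
elim: i r => [|i IHi] r ile /=.
  rewrite take0 /ideal_seq; split=> [[c ->]|->]; first by rewrite big_ord0.
  by exists (fun=> 0); rewrite big_ord0.
by rewrite (take_nth 0) // ideal_seq_rcons; split=> -[c]; exists c; apply/IHi => //; exact: ltnW.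
Qed.

(** * From strong parameter sequences to regular sequences *)

Section StrongParameterSequences.
Variable S : comPzRingType.
Hypotheses (ker : kernels_fg S) (res : finite_free_res S).

Lemma parameter_step (x : seq S) i y : (i < size x)%N -> parameter_seq (take i.+1 x) ->
  (forall j z, (j < i)%N -> initial_ideal (nth 0 x) j (x`_j * z) ->
     initial_ideal (nth 0 x) j z) ->
  initial_ideal (nth 0 x) i (x`_i * y) -> initial_ideal (nth 0 x) i y.
Proof.
move=> ix [wpr [_ top]] reg xiy; apply: contrapT => ny.
pose I := initial_ideal (nth 0 x) i; have iI : is_ideal I by exact: initial_idealP.
have [I0 [ID IM]] := iI.
have JI : is_ideal (fun r => I (r * y)).
  split; first by rewrite mul0r.
  by split=> [a b Ia Ib|r a Ia]; rewrite ?mulrDl -?mulrA; [exact: ID | exact: IM].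
(* As [q] is minimal over [I : y], its elements act nilpotently on [y] modulo [I] after localization
   at [q]. *)
have [|q [qP Jq qJ]] := minimal_prime_over JI; first by rewrite mul1r.
set xs := take i.+1 x in wpr top.
have sz : size xs = i.+1 by rewrite size_takel.
have js (j : 'I_(size xs)) : (j < i.+1)%N by case: j => j /=; rewrite sz.
have xsE j : (j < i.+1)%N -> xs`_j = x`_j by move=> ji; rewrite nth_take.
have xsq j : (j < i.+1)%N -> q x`_j.
  rewrite ltnS leq_eqVlt => /orP[/eqP->|ji]; apply: Jq; first exact: xiy.
  by rewrite mulrC; apply: IM; exact: (initial_ideal_mem (nth 0 x)).
have [[q0 [qD qM]] _] := qP.
have [|a [k nak]] := top q qP.
  move=> r [c ->]; elim/big_rec: _ => [//|j z _ qz]; apply: qD => //; apply: qM.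
  by rewrite (xsE _ (js j)); exact/xsq/js.
have [T [psi psiP]] := exists_localization_at qP.
pose xT j : T := psi x`_j.
(* [k] is the exponent in the class of [a / u^k]. The start [k.+1] is positive, as weak
   proregularity requires; its surplus factor [u] goes into the coefficients at the end. *)
have [M reach] : exists M, kreach (fun j : 'I_(size xs) => psi xs`_j) (size xs) M k.+1.
  apply: kreach_exists => // n n0; have [m [nm mz]] := wpr n n0.
  by exists m; split=> // h h0; apply: (loc_koszul_map_zero qP psiP); exact: mz.
have kM := kreach_le reach.
have [|||n [D [Dres Da ni]]] := @short_free_res T (loc_max q psi) (loc_max_ideal qP psiP)
    (loc_max_proper qP psiP) (loc_max_unit psiP) xT i _ (\col_(j < size xs) psi xs`_j ^+ M)
    (loc_kernels_fg qP psiP ker) (loc_finite_free_res qP psiP res).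
- by move=> j z ji; apply: (regular_loc qP psiP); move=> w; exact: reg.
(* If [psi y] were in the extended ideal, some [s] outside [q] would have [s * y] in [I], hence lie
   in [I : y] and so in [q]. *)
- move=> m r rm; have nyT : ~ initial_ideal xT i (psi y).
    by move=> /(initial_ideal_loc_morph qP psiP)[s [ns /Jq]].
  have [j|c [nc cP]] := socle_of_nilpotent (r := r) (initial_idealP xT i) nyT.
    have [b [u [qb nu e]]] := rm j; have [s [t [ns Ist]]] := qJ b qb; exists t.
    apply: (initial_ideal_unit psiP ns); elim: t Ist => [|t _] Ist.
      by rewrite expr0 mul1r -rmorphM; apply: initial_ideal_morph; move: Ist; rewrite mulr1.
    have nut : ~ q (u ^+ t.+1).
      by elim: t {Ist} => // t IHt; rewrite exprS; exact: prime_compl_mul.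
    apply: (initial_ideal_unit psiP nut); rewrite rmorphXn.
    have -> : psi u ^+ t.+1 * (psi s * (r j ^+ t.+1 * psi y)) = psi (s * b ^+ t.+1 * y).
      by rewrite !(rmorphM, rmorphXn) -e exprMn; ring.
    exact: initial_ideal_morph.
  by exists (c * psi y); split.
- move=> j o; rewrite mxE (xsE _ (js j)).
  (* Positivity of [M] puts the powers of the sequence into the maximal ideal. *)
  have [M' ->] : exists M', M = M'.+1 by exists M.-1; rewrite prednK // (leq_trans _ kM).
  rewrite exprSr; apply: (idealM (loc_max_ideal qP psiP)).
  exists x`_j, 1; split; [exact/xsq/js | exact: prime_not1 qP |].
  by rewrite rmorph1 mulr1.
have [|b bP] := koszul_top_vanish Dres _ reach Da; first by rewrite sz.
have [s [c [ns sb]]] := common_denominator qP psiP b.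
pose u := \prod_(j < size xs) xs`_j.
have [|t [nt e]] := common_annihilator qP psiP
    (a := fun _ : 'I_1 => s * u ^+ (M - k.+1) - \sum_j c j * xs`_j ^+ M).
  move=> _; rewrite rmorphB rmorphM rmorphXn rmorph_prod -prodrXl bP mulr_sumr rmorph_sum.
  by rewrite -sumrB big1 // => j _; rewrite mulrA sb rmorphM rmorphXn subrr.
apply: (nak (t * s)); first exact: prime_compl_mul.
(* Write [u ^+ M] as [u * u ^+ k * u ^+ (M - k.+1)]: by [e], the last factor times [t * s] is [t]
   times a combination of the [M]-th powers, [u ^+ k] is the factor in [top_cech_image], and [u * a]
   enters the coefficients. *)
exists M, 0%N, (fun j => u * a * t * c j); rewrite expr0 mul1r -/u.
have := e ord0; rewrite mulrBr => /eqP; rewrite subr_eq0 => /eqP {}e.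
have -> : u ^+ M = u * u ^+ k * u ^+ (M - k.+1) by rewrite -exprS -exprD subnKC.
have -> : \sum_j u * a * t * c j * xs`_j ^+ M = u * a * (t * \sum_j c j * xs`_j ^+ M).
  by rewrite !mulr_sumr; apply: eq_bigr => j _; ring.
by rewrite -e; ring.
Qed.

Lemma finite_free_res_cohen_macaulay : (1 : S) <> 0 -> cohen_macaulay S.
Proof.
move=> S1 x xP; split; last first.
  (* [strong_parameter_seq] says nothing about the empty sequence, for which properness is
     [1 <> 0]. *)
  case: (posnP (size x)) => [/size0nil->|x0].
    by move=> [c]; rewrite big_ord0.
  have [|_ [+ _]] := xP (size x); first by rewrite x0 leqnn.
  by rewrite take_size.
suff reg j z : (j < size x)%N -> initial_ideal (nth 0 x) j (x`_j * z) ->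
    initial_ideal (nth 0 x) j z.
  move=> i ix y; rewrite !ideal_seq_take ?(ltnW ix) //; exact: reg.
elim/ltn_ind: j z => j IHj z jx; apply: parameter_step => //.
  by apply: xP; rewrite jx.
by move=> l w lj; apply: IHj => //; exact: ltn_trans jx.
Qed.

End StrongParameterSequences.

Theorem theorem4p8 (R : comPzRingType) :
  coherent R -> regular_ring R ->
  forall p : R -> Prop, is_prime_ideal p ->
  forall (S : comPzRingType) (phi : {rmorphism R -> S}),
    is_localization_at p phi -> cohen_macaulay S.
Proof.
move=> coh reg p pP S phi phiP; apply: finite_free_res_cohen_macaulay.
- exact: (loc_kernels_fg pP phiP (coherent_kernels_fg coh)).
- exact: (loc_finite_free_res pP phiP (coherent_regular_finite_free_res coh reg)).
(* If [S] were the zero ring, some element outside [p] would be 0, which lies in [p]. *)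
- move=> S1; have [_ [_ ann]] := phiP; have [|s [ns]] := ann 1; first by rewrite rmorph1.
  by rewrite mulr1 => s0; apply: ns; rewrite s0; case: pP => -[].
Qed.
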